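(* Let $\mathbb{T}_1,\mathbb{T}_2$ be time scales that are unbounded above, let $\alpha\in\mathbb{T}_1$, $\beta\in\mathbb{T}_2$, and consider the intervals $[\alpha,\infty)\subset\mathbb{T}_1$ and $[\beta,\infty)\subset\mathbb{T}_2$. Let $K:[\alpha,\infty)\times[\beta,\infty)\to\mathbb{R}$ be a function such that $K(x,\cdot)\in\mathcal{R}_{\mathbb{T}_2}[\beta,\infty)$ for each $x\in[\alpha,\infty)$. Suppose the following conditions are satisfied: (i) $\displaystyle\lim_{x\to x_0}\int_\beta^\infty |K(x,t)-K(x_0,t)|\,\Delta t=0$ for all $x_0\in[\alpha,\infty)$; (ii) $\displaystyle M=\sup_{\alpha\le x<\infty}\int_\beta^\infty |K(x,t)|\,\Delta t<\infty$; (iii) $\displaystyle\lim_{x\to\infty}\int_\beta^y |K(x,t)|\,\Delta t=0$ for all $y\in[\beta,\infty)$. Then the operator $L$ given by $$(Lf)(x)=\int_\beta^\infty K(x,t)f(t)\,\Delta t,\qquad x\in[\alpha,\infty),$$ belongs to $(C^0_{\mathbb{T}_2}[\beta,\infty),\,C^0_{\mathbb{T}_1}[\alpha,\infty))$. Moreover $\|L\|=M$.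
   Context: A time scale $\mathbb{T}$ is a nonempty closed subset of $\mathbb{R}$, with the topology inherited from $\mathbb{R}$. All time scales are assumed unbounded above. Intervals are taken in the time scale: $[a,b]=\{t\in\mathbb{T}:a\le t\le b\}$, $[\beta,\infty)=\{t\in\mathbb{T}:t\ge\beta\}$ (with $a,b,\beta\in\mathbb{T}$), and similarly for half-open intervals. In the claim, variables $x,x_0$ range over the interval $[\alpha,\infty)$ of $\mathbb{T}_1$ and $t,y$ over the interval $[\beta,\infty)$ of $\mathbb{T}_2$. The backward jump operator is $\rho(t)=\sup\{s\in\mathbb{T}:s<t\}$. Riemann $\Delta$-integral: for $a<b$ in $\mathbb{T}$, a partition of $[a,b]$ is a finite set $P=\{t_0,\dots,t_n\}\subset[a,b]$ with $a=t_0<t_1<\dots<t_n=b$. For $\delta>0$, $\mathcal{P}_\delta(a,b)$ is the set of partitions such that for each $i\in\{1,\dots,n\}$ either $t_i-t_{i-1}\le\delta$, or $t_i-t_{i-1}>\delta$ and $\rho(t_i)=t_{i-1}$. A Riemann sum of $f$ for $P$ is $S=\sum_{i=1}^n f(\xi_i)(t_i-t_{i-1})$ with arbitrary $\xi_i\in[t_{i-1},t_i)$. The function $f$ is Riemann $\Delta$-integrable on $[a,b]$ with integral $I=\int_a^b f(t)\Delta t$ if for each $\varepsilon>0$ there is $\delta>0$ such that $|S-I|<\varepsilon$ for every Riemann sum $S$ of $f$ corresponding to any $P\in\mathcal{P}_\delta(a,b)$, independently of the choice of the $\xi_i$. The improper integral is $\int_a^\infty f(t)\Delta t=\lim_{A\to\infty,\,A\in\mathbb{T}}\int_a^A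 f(t)\Delta t$ when this limit exists and is finite. $\mathcal{R}_{\mathbb{T}}[\beta,\infty)$ is the set of real-valued functions on $[\beta,\infty)\subset\mathbb{T}$ that are Riemann $\Delta$-integrable on every bounded subinterval of $[\beta,\infty)$. $C^0_{\mathbb{T}}[\beta,\infty)=\{f\in\mathcal{R}_{\mathbb{T}}[\beta,\infty):\lim_{t\to\infty}f(t)=0\}$, equipped with the norm $\|f\|=\sup_{\beta\le t<\infty}|f(t)|$. For normed spaces $X,Y$, $(X,Y)$ denotes the set of bounded linear operators from $X$ to $Y$, and $\|L\|$ is the operator norm. *)

(* Defs.v *)
From HB Require Import structures.
From mathcomp Require Import all_boot all_order all_algebra.
From mathcomp Require Import all_classical all_reals all_analysis.

Set Implicit Arguments.
Unset Strict Implicit.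
Unset Printing Implicit Defensive.

Import Order.TTheory GRing.Theory Num.Theory.
Import numFieldTopology.Exports numFieldNormedType.Exports.
Local Open Scope classical_set_scope.
Local Open Scope ring_scope.

Record timeScale (R : realType) := TimeScale {
  ts_set :> set R;
  ts_closed : closed ts_set;
  ts_nonempty : ts_set !=set0;
  ts_unbounded : ~ has_ubound ts_set }.

Lemma ts_adherent (R : realType) (T : timeScale R) (x : R) :
  (forall e, 0 < e -> exists2 y, ts_set T y & `|x - y| < e) -> ts_set T x.
Proof.
move=> h; apply: ts_closed => B /nbhs_ballP[e e0 Be].
by have [y Ty xy] := h e e0; exists y; split=> //; exact: Be.
Qed.

(* Only used at points [t] with a predecessor in [T], so that the supremum is
   over a nonempty set bounded above. *)
Definition ts_rho (R : realType) (T : timeScale R) (t : R) : R :=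
  sup [set s | ts_set T s /\ s < t].

(* [b : T] uses the coercion from sets to types. The type [ray b] carries the
   topology inherited from the reals. *)
Definition ray (R : realType) (T : timeScale R) (b : T) : set R :=
  [set t | ts_set T t /\ val b <= t].

Section rays.
Context (R : realType) (T : timeScale R) (b : T).

Definition ray_at (t : R) (Tt : ts_set T t) (bt : val b <= t) : ray b :=
  SigSub (mem_set (conj Tt bt : ray b t)).

Definition ray_min : ray b := ray_at (set_mem (valP b)) (lexx _).

(* The filter of the limits "t tends to infinity, t in T". *)
Definition ray_oo : set_system (ray b) :=
  filter_from setT (fun A : R => [set t : ray b | A < val t]).

Lemma ray_ts (t : ray b) : ts_set T (val t).
Proof. by have [] := set_valP t. Qed.

Lemma ray_ge (t : ray b) : val b <= val t.
Proof. by have [] := set_valP t. Qed.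

Lemma ray_unbounded (A : R) : exists t : ray b, A < val t.
Proof.
apply: contrapT => h; apply: (@ts_unbounded _ T).
exists (Num.max A (val b)) => t Tt; rewrite leNgt; apply/negP.
rewrite gt_max => /andP[At bt]; apply: h.
by exists (ray_at Tt (ltW bt)).
Qed.

Global Instance ray_oo_proper : ProperFilter ray_oo.
Proof.
apply: filter_from_proper => [|A _]; last exact: ray_unbounded.
apply: filter_from_filter; first by exists 0.
move=> A B _ _; exists (Num.max A B) => // t /=.
by rewrite gt_max => /andP[].
Qed.

End rays.

Arguments ray_oo {R T} b.

Section delta_integral.
Context (R : realType) (T : timeScale R) (b : T).
Implicit Types (f g : ray b -> R) (u v w : ray b) (t xi : nat -> ray b).

(* [t 0, ..., t n] is a partition of [[u, v]] belonging to P_delta(u, v). The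
   case [n = 0] only occurs for [u = v]; it makes every integral over [[u, u]]
   equal to 0. *)
Definition fine_partition (delta : R) u v (n : nat) t : Prop :=
  [/\ t 0%N = u, t n = v &
    forall i, (i < n)%N -> val (t i) < val (t i.+1) /\
      (val (t i.+1) - val (t i) <= delta \/
       delta < val (t i.+1) - val (t i) /\
       ts_rho T (val (t i.+1)) = val (t i))].

Definition tags (n : nat) t xi : Prop :=
  forall i, (i < n)%N -> val (t i) <= val (xi i) < val (t i.+1).

Definition riemann_sum f (n : nat) t xi : R :=
  \sum_(i < n) f (xi i) * (val (t i.+1) - val (t i)).

Definition is_delta_integral f u v (I : R) : Prop :=
  forall e, 0 < e -> exists2 delta, 0 < delta &
    forall n t xi, fine_partition delta u v n t -> tags n t xi ->
      `|riemann_sum f n t xi - I| < e.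

Definition delta_integrable f u v : Prop := exists I, is_delta_integral f u v I.

Definition delta_integral f u v : R := xget 0 [set I | is_delta_integral f u v I].

Definition is_improper_integral f u (I : R) : Prop :=
  (forall v, val u < val v -> delta_integrable f u v) /\
  delta_integral f u v @[v --> ray_oo b] --> I.

Definition improper_integrable f u : Prop :=
  exists I, is_improper_integral f u I.

Definition improper_integral f u : R :=
  xget 0 [set I | is_improper_integral f u I].

Definition locally_delta_integrable f : Prop :=
  forall u v, val u < val v -> delta_integrable f u v.

Definition C0_set : set (ray b -> R) :=
  [set f | locally_delta_integrable f /\ f @ ray_oo b --> (0 : R)].

Definition C0_pred : {pred ray b -> R} := mem C0_set.

End delta_integral.

Section delta_integral_lemmas.
Context (R : realType) (T : timeScale R) (b : T).
Implicit Types (f g : ray b -> R) (u v w : ray b) (t xi : nat -> ray b).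

Lemma fine_partition_le (d d' : R) u v n t :
  d <= d' -> fine_partition d u v n t -> fine_partition d' u v n t.
Proof.
move=> dd' [t0 tn h]; split=> // i /h[lt_t ht]; split=> //.
have [le|gt] := leP (val (t i.+1) - val (t i)) d'; first by left.
right; split=> //; case: ht => [|[]//] le.
by move: gt; rewrite ltNge (le_trans le dd').
Qed.

Lemma is_delta_integralD f g u v (I J : R) :
  is_delta_integral f u v I -> is_delta_integral g u v J ->
  is_delta_integral (f + g) u v (I + J).
Proof.
move=> hf hg e e0.
have [d1 d10 h1] := hf _ (divr_gt0 e0 (ltr0n R 2)).
have [d2 d20 h2] := hg _ (divr_gt0 e0 (ltr0n R 2)).
exists (Num.min d1 d2); first by rewrite lt_min d10.
move=> n t xi P X.
have -> : riemann_sum (f + g) n t xi = riemann_sum f n t xi + riemann_sum g n t xi.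
  by rewrite /riemann_sum -big_split; apply: eq_bigr => i _; rewrite /= mulrDl.
rewrite opprD addrACA (le_lt_trans (ler_normD _ _))// (splitr e) ltrD//.
  by apply: h1 => //; apply: fine_partition_le P; rewrite ge_min lexx.
by apply: h2 => //; apply: fine_partition_le P; rewrite ge_min lexx orbT.
Qed.

Lemma is_delta_integralZ (a : R) f u v (I : R) :
  is_delta_integral f u v I -> is_delta_integral (a *: f) u v (a * I).
Proof.
move=> hf e e0.
have a0 : 0 < `|a| + 1 by rewrite ltr_wpDl.
have [d d0 h] := hf _ (divr_gt0 e0 a0).
exists d => // n t xi P X.
have -> : riemann_sum (a *: f) n t xi = a * riemann_sum f n t xi.
  by rewrite /riemann_sum mulr_sumr; apply: eq_bigr => i _; rewrite mulrA.
rewrite -mulrBr normrM (@le_lt_trans _ _ ((`|a| + 1) * `|riemann_sum f n t xi - I|))//.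
  by rewrite ler_wpM2r// lerDl.
by rewrite mulrC -ltr_pdivlMr// h.
Qed.

Lemma is_delta_integral0 u v : is_delta_integral (0 : ray b -> R) u v 0.
Proof.
move=> e e0; exists 1 => // n t xi _ _.
by rewrite /riemann_sum big1 ?subr0 ?normr0// => i _; rewrite mul0r.
Qed.

Lemma fine_partition_rcons (d : R) u v w n t :
  fine_partition d u v n t -> val v < val w ->
  (val w - val v <= d \/ ts_rho T (val w) = val v) ->
  exists n' t', fine_partition d u w n' t'.
Proof.
move=> [t0 tn h] vw hvw.
exists n.+1, (fun i => if (i <= n)%N then t i else w); split=> //.
  by rewrite ltnn.
move=> i lt_in1; have [->|ne_in] := eqVneq i n; last first.
  have lt_in : (i < n)%N by rewrite ltn_neqAle ne_in -ltnS.
  by rewrite (ltnW lt_in) lt_in; exact: h.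
rewrite leqnn ltnn tn; split=> //.
have [le|gt] := leP (val w - val v) d; first by left.
by right; split=> //; case: hvw => // /le_lt_trans/(_ gt); rewrite ltxx.
Qed.

Lemma fine_partition_exists (d : R) u v :
  0 < d -> val u <= val v -> exists n t, fine_partition d u v n t.
Proof.
move=> d0 uv.
pose S := [set x : R | exists w : ray b, [/\ val w = x, val u <= x <= val v &
  exists n t, fine_partition d u w n t]].
have Su : S (val u).
  exists u; split=> //; first by rewrite lexx.
  by exists 0%N, (fun=> u); split.
have Sub : has_sup S.
  by split; [exists (val u)|exists (val v) => x [w [_ /andP[]]]].
set s := sup S.
have us : val u <= s by apply: ub_le_sup => //; case: Sub.
have sv : s <= val v by apply: ge_sup => [|x [w [_ /andP[]]]//]; exists (val u).
have Ts : ts_set T s.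
  apply: ts_adherent => e e0; have [x Sx sx] := sup_adherent e0 Sub.
  exists x; first by case: Sx => w [<- _ _]; exact: ray_ts.
  by rewrite ger0_norm ?subr_ge0 ?ub_le_sup ?ltrBlDr -?ltrBlDl//; case: Sub.
pose rs : ray b := ray_at Ts (le_trans (ray_ge u) us).
have Ss : S s.
  have [x Sx sx] := sup_adherent d0 Sub; rewrite -/s in sx.
  have /ub_le_sup -/(_ _ Sx) xs := Sub.2; rewrite -/s in xs.
  case: Sx => w [wx uxv [n [t P]]].
  have [ws|sw] := ltP (val w) s; last first.
    exists w; split; [|by rewrite us|by exists n, t].
    by apply/eqP; rewrite eq_le sw wx xs.
  exists rs; split=> //; first by rewrite us.
  apply: (fine_partition_rcons P) => //=; left.
  by rewrite lerBlDr -lerBlDl wx ltW.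
have [sv'|vs] := ltP s (val v); last first.
  case: Ss => w [ws _ [n [t P]]]; exists n, t.
  suff -> : v = w by [].
  by apply: val_inj; rewrite ws; apply/eqP; rewrite eq_le vs.
have notS w : s < val w -> val w <= val v -> ~ exists n t, fine_partition d u w n t.
  move=> sw wv P; have : val w <= s.
    apply: ub_le_sup; first by case: Sub.
    by exists w; split=> //; rewrite wv (le_trans us (ltW sw)).
  by rewrite leNgt sw.
have {}Ss : exists n t, fine_partition d u rs n t.
  case: Ss => w [ws _ P]; suff -> : rs = w by [].
  exact: val_inj.
case: Ss => n [t P].
have far w : s < val w -> val w <= val v -> d < val w - s.
  move=> sw wv; rewrite ltNge; apply/negP => le.
  apply: (notS w sw wv); apply: (fine_partition_rcons P) => //.
  by left.
pose G := [set x | ts_set T x /\ s < x].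
have Gv : G (val v) by split=> //; exact: ray_ts.
have Glb : lbound G (s + d).
  move=> x [Tx sx].
  have [xv|vx] := leP x (val v).
    have /= := far (ray_at Tx (le_trans (ray_ge rs) (ltW sx))) sx xv.
    by rewrite ltrBrDl => /ltW.
  have := far v sv' (lexx _); rewrite ltrBrDl => /ltW/le_trans; apply.
  exact: ltW.
have Ginf : has_inf G by split; [exists (val v)|exists (s + d)].
have sg : s + d <= inf G by apply: lb_le_inf => //; exists (val v).
have sg' : s < inf G by rewrite (lt_le_trans _ sg)// ltrDl.
have Tg : ts_set T (inf G).
  apply: ts_adherent => e e0; have [x Gx xg] := inf_adherent e0 Ginf.
  exists x; first by case: Gx.
  by rewrite distrC ger0_norm ?subr_ge0 ?ge_inf ?ltrBlDl//; case: Ginf.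
pose g : ray b := ray_at Tg (le_trans (ray_ge rs) (ltW sg')).
have gv : inf G <= val v by apply: ge_inf => //; case: Ginf.
exfalso; apply: (notS g) => //=.
apply: (fine_partition_rcons P) => //=; right.
apply/eqP; rewrite eq_le; apply/andP; split.
  apply: ge_sup => [|x [Tx xg]]; first by exists s.
  rewrite leNgt; apply/negP => sx.
  have : inf G <= x by apply: ge_inf => //; case: Ginf.
  by rewrite leNgt xg.
apply: ub_le_sup; last by split.
by exists (inf G) => x [_ /ltW].
Qed.

Lemma delta_integrable_bounded f u v : val u < val v -> delta_integrable f u v ->
  exists C : R, forall w, val u <= val w < val v -> `|f w| <= C.
Proof.
move=> uv [I /(_ 1 ltr01)[d d0 h]].
have [n [t P]] := fine_partition_exists d0 (ltW uv).
have [t0 tn ht] := P.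
have tt : tags n t t by move=> i /ht[lt_t _]; rewrite lexx.
have block i : (i < n)%N -> exists C : R,
    forall w, val (t i) <= val w < val (t i.+1) -> `|f w| <= C.
  move=> lt_in; have [lt_t _] := ht _ lt_in.
  have l0 : 0 < val (t i.+1) - val (t i) by rewrite subr_gt0.
  exists (2 / (val (t i.+1) - val (t i)) + `|f (t i)|) => w wi.
  pose xi j := if j == i then w else t j.
  have xt : tags n t xi.
    by move=> j lt_jn; rewrite /xi; case: eqP => [->//|_]; exact: tt.
  have h1 := h _ _ _ P tt; have h2 := h _ _ _ P xt.
  have : `|riemann_sum f n t xi - riemann_sum f n t t| < 2.
    have -> : riemann_sum f n t xi - riemann_sum f n t t =
        (riemann_sum f n t xi - I) - (riemann_sum f n t t - I) by rewrite opprB addrA subrK.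
    by rewrite (le_lt_trans (ler_normB _ _))// (_ : 2 = 1 + 1 :> R)// ltrD.
  rewrite /riemann_sum -sumrB (bigD1 (Ordinal lt_in))//= big1 => [|j /eqP ji].
    rewrite addr0 /xi eqxx -mulrBl normrM (gtr0_norm l0) -ltr_pdivlMr// => hw.
    rewrite -lerBlDr (le_trans _ (ltW hw))//.
    by rewrite (le_trans (lerB_dist _ _))// lerB_dist.
  rewrite /xi; case: eqP => [ji'|_]; last by rewrite subrr.
  by exfalso; apply: ji; exact: val_inj.
suff H m : (m <= n)%N -> exists C : R,
    forall w, val u <= val w < val (t m) -> `|f w| <= C.
  by have := H n (leqnn _); rewrite tn.
elim: m => [_|m IH lt_mn].
  exists 0 => w; rewrite t0 => /andP[uw wu].
  by have := le_lt_trans uw wu; rewrite ltxx.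
have [C1 h1] := IH (ltnW lt_mn); have [C2 h2] := block _ lt_mn.
exists (Num.max C1 C2) => w /andP[uw wt]; rewrite le_max.
have [wm|mw] := ltP (val w) (val (t m)); first by rewrite h1// uw.
by rewrite h2 ?orbT// mw.
Qed.

Lemma C0_set_bounded f : C0_set f -> has_ubound (range (fun w => `|f w|)).
Proof.
move=> [fi /cvgrPdist_lt/(_ 1 ltr01)[A _ hA]].
have [v] := @ray_unbounded _ _ b (Num.max A (val b)); rewrite gt_max => /andP[Av bv].
have {}bv : val (ray_min b) < val v := bv.
have [C hC] := delta_integrable_bounded bv (fi _ _ bv).
exists (Num.max C 1) => _ [w _ <-]; rewrite le_max.
have [wv|vw] := ltP (val w) (val v); first by rewrite hC// ray_ge.
have /ltW := hA w (lt_le_trans Av vw); rewrite sub0r normrN => ->.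
by rewrite orbT.
Qed.

Lemma C0_set_submod_closed : submod_closed (C0_pred (b := b)).
Proof.
split.
  apply: mem_set; split; last exact: cvg_cst.
  by move=> u v _; exists 0; exact: is_delta_integral0.
move=> a f g /set_mem[fi f0] /set_mem[gi g0]; apply: mem_set; split.
  move=> u v uv; have [I hI] := fi u v uv; have [J hJ] := gi u v uv.
  by exists (a * I + J); apply: is_delta_integralD => //; exact: is_delta_integralZ.
rewrite -[X in _ --> X](addr0 (0 : R)) -[X in _ --> X + _](mulr0 a).
by apply: cvgD => //; apply: cvgM => //; exact: cvg_cst.
Qed.

End delta_integral_lemmas.

Section C0.
Context (R : realType) (T : timeScale R) (b : T).

HB.instance Definition _ := GRing.isSubmodClosed.Build R (ray b -> R) (C0_pred (b := b))
  (@C0_set_submod_closed R T b).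

Record C0 := MkC0 { C0_fun :> ray b -> R; C0_mem : C0_fun \in C0_pred (b := b) }.

HB.instance Definition _ := [isSub for C0_fun].
HB.instance Definition _ := [Choice of C0 by <:].
HB.instance Definition _ := [SubChoice_isSubLmodule of C0 by <:].

Definition C0_norm (f : C0) : R := sup (range (fun t => `|f t|)).

Lemma C0_le_norm (f : C0) t : `|f t| <= C0_norm f.
Proof.
by apply: ub_le_sup; [apply/C0_set_bounded/set_mem/C0_mem|exists t].
Qed.

Lemma C0_norm_le (f : C0) (C : R) : (forall t, `|f t| <= C) -> C0_norm f <= C.
Proof.
move=> h; apply: ge_sup => [|_ [t _ <-]//].
by exists `|f (ray_min b)|; exists (ray_min b).
Qed.

Lemma C0_ler_normD f g : C0_norm (f + g) <= C0_norm f + C0_norm g.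
Proof.
apply: C0_norm_le => t /=.
by rewrite (le_trans (ler_normD _ _))// lerD// C0_le_norm.
Qed.

Lemma C0_normrZ (a : R) f : C0_norm (a *: f) = `|a| * C0_norm f.
Proof.
have le c h : C0_norm (c *: h) <= `|c| * C0_norm h.
  by apply: C0_norm_le => t /=; rewrite normrM ler_wpM2l// C0_le_norm.
apply/eqP; rewrite eq_le le /=; have [->|a0] := eqVneq a 0.
  by rewrite normr0 mul0r (le_trans _ (C0_le_norm _ (ray_min b))).
rewrite -ler_pdivlMl ?normr_gt0// -normfV.
by rewrite -[X in C0_norm X <= _](scalerK a0) le.
Qed.

Lemma C0_normr0_eq0 f : C0_norm f = 0 -> f = 0.
Proof.
move=> f0; apply: val_inj; apply/funext => t /=.
by apply/eqP; rewrite -normr_le0 -f0 C0_le_norm.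
Qed.

HB.instance Definition _ :=
  Lmodule_isNormed.Build R C0 C0_ler_normD C0_normrZ C0_normr0_eq0.

End C0.

Section operators.
Context (R : realType) (X Y : normedModType R).

Definition bounded_operator (L : X -> Y) : Prop :=
  exists C : R, forall f, `|L f| <= C * `|f|.

Definition operator_norm (L : X -> Y) : R :=
  sup [set `|L f| | f in [set f : X | `|f| <= 1]].

End operators.

(* Main.v *)
Require Import Defs.
From HB Require Import structures.
From mathcomp Require Import all_boot all_order all_algebra.
From mathcomp Require Import all_classical all_reals all_analysis.
From mathcomp Require Import ring lra.

Set Implicit Arguments.
Unset Strict Implicit.
Unset Printing Implicit Defensive.

Import Order.TTheory GRing.Theory Num.Theory.
Import numFieldTopology.Exports numFieldNormedType.Exports.
Local Open Scope classical_set_scope.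
Local Open Scope ring_scope.

(** The operator [L] is bounded by [M] because [|(L f)(x)|] is at most
    [`|f|] times the integral of [`|K x t|]; the rest is to show that [L f] lies
    in [C0 alpha] and that the bound is attained in the limit.

    Everything rests on a criterion for integrability: a function is integrable
    over [[u, v]] exactly when its oscillation sums over fine partitions are
    small ([delta_integrable_small_oscillation],
    [small_oscillation_delta_integrable]). The direction from oscillation to
    integrability compares the Riemann sums of two partitions through the
    overlaps of their steps ([riemann_sum_dist]). The criterion gives at once
    the integrability of products, absolute values and Lipschitz images, and,
    by uniform continuity on compact sets, of continuous functions
    ([continuous_locally_delta_integrable]).

    Since [f] is bounded, the improper integral of [K x t * f t] exists by
    comparison with that of [`|K x t|] ([improper_integrable_dominated]).
    The rows of the kernel depend continuously on [x] in the mean, so [L f] is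
    continuous, hence locally integrable ([kernel_op_continuous]). For the limit
    of [L f] at infinity the integral is split at a [y] after which [f] is small:
    the part before [y] tends to zero with the integral of [`|K x t|] over
    [[beta, y]], and the tail is small because the rows have mass at most [M]
    ([kernel_op_cvg0]).

    For the lower bound on the operator norm, fix [x] and a small [eta]. The
    test function is the truncation of [K x t / eta] to [[-1, 1]], a Lipschitz
    function of [K x t] that replaces its sign, multiplied by a cutoff that
    makes it vanish at infinity. Its image under [L] at [x] is as close as desired to the
    integral of [`|K x t|] ([improper_integral_norm_approx]). *)

(** * Truncation and overlaps of intervals *)

Section overlap.
Context (R : realType).
Implicit Types a q x : R.

Definition clip a a' x : R := Num.max a (Num.min a' x).

(** The length of the intersection of [[a, a')] and [[q, q')]: an increment of
    [clip a a'], so that its sum over the steps of a partition telescopes. *)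
Definition overlap a a' q q' : R := clip a a' q' - clip a a' q.

Lemma overlapC a a' q q' :
  a <= a' -> q <= q' -> overlap a a' q q' = overlap q q' a a'.
Proof.
rewrite /overlap /clip => aa qq.
case: (leP a' q'); case: (leP a' q); case: (leP q' a'); case: (leP q' a);
  rewrite ?maxEle; do ?case: ifP; move=> *; lra.
Qed.

Lemma clip_homo a a' : {homo clip a a' : x y / x <= y}.
Proof. by move=> x y xy; rewrite /clip ge_max !le_max lexx /= le_min !ge_min lexx xy !orbT. Qed.

Lemma overlap_ge0 a a' q q' : q <= q' -> 0 <= overlap a a' q q'.
Proof. by move=> qq; rewrite subr_ge0 clip_homo. Qed.

Lemma overlap_gt0 a a' q q' : a <= a' ->
  0 < overlap a a' q q' -> Num.max a q < Num.min a' q'.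
Proof.
rewrite /overlap /clip => aa.
rewrite gt_max !lt_min.
case: (leP a' q'); case: (leP a' q);
  rewrite ?maxEle; do ?case: ifP; move=> *;
  apply/andP; split; apply/andP; split; lra.
Qed.

Lemma clip_bounds a a' x : a <= a' -> a <= clip a a' x <= a'.
Proof. by move=> aa; rewrite /clip le_max lexx/= ge_max aa ge_min lexx. Qed.

Lemma clip_le a a' x : x <= a -> clip a a' x = a.
Proof. by move=> xa; apply/max_idPl; rewrite ge_min xa orbT. Qed.

Lemma clip_ge a a' x : a <= a' -> a' <= x -> clip a a' x = a'.
Proof. by move=> aa ax; rewrite /clip (min_idPl ax); apply/max_idPr. Qed.

Lemma clip_lip a a' x y : `|clip a a' x - clip a a' y| <= `|x - y|.
Proof.
wlog xy : x y / y <= x => [wl|].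
  by have [/wl//|/ltW/wl] := leP y x; rewrite distrC (distrC x).
rewrite !ger0_norm ?subr_ge0 ?clip_homo// /clip.
case: (leP a' x); case: (leP a' y); case: (leP a x); case: (leP a y);
  case: (leP a a') => *; lra.
Qed.

(** The truncation of [s / eta] is the sign of [s] when [`|s| >= eta]; otherwise
    [`|s| - eta] is negative and the product nonnegative. *)
Lemma truncation_sign (eta s : R) : 0 < eta ->
  0 <= s * clip (-1) 1 (eta^-1 * s) /\
  `|s| - eta <= s * clip (-1) 1 (eta^-1 * s).
Proof.
move=> eta0; have [s1|s1] := leP eta s.
  rewrite clip_ge ?mulr1; [|lra|by rewrite ler_pdivlMl// mulr1].
  by rewrite ger0_norm; lra.
have [s2|s2] := leP s (- eta).
  rewrite clip_le ?mulrN1; last by rewrite ler_pdivrMl// mulrN1.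
  by rewrite ler0_norm; lra.
have -> : clip (-1) 1 (eta^-1 * s) = eta^-1 * s.
  rewrite /clip (min_idPr _) ?(max_idPr _)//.
    by rewrite ler_pdivlMl// mulrN1 ltW.
  by rewrite ler_pdivrMl// mulr1 ltW.
have h : 0 <= s * (eta^-1 * s) by rewrite mulrCA mulr_ge0 ?invr_ge0 ?(ltW eta0) -?expr2 ?sqr_ge0.
split=> //; apply: le_trans h; rewrite subr_le0 ler_norml; lra.
Qed.

End overlap.

(** * Partitions and Riemann sums *)

Section partitions.
Context (R : realType) (T : timeScale R) (b : T).
Implicit Types (f g : ray b -> R) (u v w : ray b) (t q xi zeta : nat -> ray b).
Implicit Types (n m : nat) (d e : R).

Lemma fine_partition_le_homo d u v n t i j : fine_partition d u v n t ->
  (i <= j <= n)%N -> val (t i) <= val (t j).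
Proof.
move=> [_ _ h]; elim: j => [|j IH]; first by rewrite leqn0 => /andP[/eqP->].
rewrite leq_eqVlt => /andP[/orP[/eqP->//|ij] jn].
have [lt_t _] := h _ jn.
by rewrite (le_trans _ (ltW lt_t))// IH// -ltnS ij ltnW.
Qed.

Lemma fine_partition_bounds d u v n t i : fine_partition d u v n t ->
  (i <= n)%N -> val u <= val (t i) <= val v.
Proof.
move=> P lein; have [t0 tn _] := P.
by rewrite -t0 -tn !(fine_partition_le_homo P)//= lein/=.
Qed.

Lemma tag_bounds d u v n t xi i : fine_partition d u v n t -> tags n t xi ->
  (i < n)%N -> val u <= val (xi i) < val v.
Proof.
move=> P X lt_in; have /andP[h1 h2] := X _ lt_in.
have /andP[h3 _] := fine_partition_bounds P (ltnW lt_in).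
have /andP[_ h4] := fine_partition_bounds P lt_in.
by rewrite (le_trans h3)//= (lt_le_trans h2).
Qed.

Lemma fine_partition_step d u v n t i : fine_partition d u v n t ->
  (i < n)%N -> val (t i) <= val (t i.+1).
Proof. by move=> [_ _ h] /h[/ltW]. Qed.

Lemma sum_steps d u v n t : fine_partition d u v n t ->
  \sum_(i < n) (val (t i.+1) - val (t i)) = val v - val u.
Proof.
move=> [<- <- _].
by rewrite -(big_mkord xpredT (fun i => val (t i.+1) - val (t i))) telescope_sumr.
Qed.

Lemma tags_self d u v n t : fine_partition d u v n t -> tags n t t.
Proof. by move=> [_ _ h] i /h[lt_t _]; rewrite lexx. Qed.

Lemma riemann_sum_le f g d u v n t xi : fine_partition d u v n t -> tags n t xi ->
  (forall w, val u <= val w < val v -> f w <= g w) ->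
  riemann_sum f n t xi <= riemann_sum g n t xi.
Proof.
move=> P X fg; apply: ler_sum => i _.
rewrite ler_wpM2r ?subr_ge0 ?(fine_partition_step P)//.
by apply: fg; exact: (tag_bounds P X).
Qed.

(** * Integrability and oscillation *)

Definition oscillation_sum f n t xi zeta : R :=
  \sum_(i < n) `|f (xi i) - f (zeta i)| * (val (t i.+1) - val (t i)).

Definition small_oscillation f u v : Prop :=
  forall e, 0 < e -> exists2 d, 0 < d &
    forall n t xi zeta, fine_partition d u v n t -> tags n t xi -> tags n t zeta ->
      oscillation_sum f n t xi zeta <= e.

(** Exchanging the two tags of the steps on which [f] is larger at the second
    one makes all the differences nonnegative: the oscillation sum is then a
    difference of two Riemann sums, both close to the integral. *)
Lemma delta_integrable_small_oscillation f u v :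
  delta_integrable f u v -> small_oscillation f u v.
Proof.
move=> [I hI] e e0; have [d d0 h] := hI _ (divr_gt0 e0 (ltr0n R 2)).
exists d => // n t xi zeta P X Z.
pose hi i := if f (zeta i) <= f (xi i) then xi i else zeta i.
pose lo i := if f (zeta i) <= f (xi i) then zeta i else xi i.
have thi : tags n t hi by move=> i lt_in; rewrite /hi; case: ifP => _; [exact: X|exact: Z].
have tlo : tags n t lo by move=> i lt_in; rewrite /lo; case: ifP => _; [exact: Z|exact: X].
have -> : oscillation_sum f n t xi zeta = riemann_sum f n t hi - riemann_sum f n t lo.
  rewrite /riemann_sum -sumrB; apply: eq_bigr => i _; rewrite -mulrBl /hi /lo.
  by congr (_ * _); case: leP => h1; [rewrite ger0_norm ?subr_ge0|rewrite ltr0_norm ?subr_lt0// opprB].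
have := h _ _ _ P thi; have := h _ _ _ P tlo; rewrite !ltr_norml => /andP[? ?] /andP[? ?].
lra.
Qed.

(** A double sum over the pieces [w i j] into which another partition cuts the
    steps of [t] is controlled by a single oscillation sum: in each step it
    suffices to use the worst of the finitely many points [z i j]. *)
Lemma oscillation_sum_refine f d u v n t xi e m (w : nat -> nat -> R)
    (z : nat -> nat -> ray b) :
  fine_partition d u v n t -> tags n t xi ->
  (forall zeta, tags n t zeta -> oscillation_sum f n t xi zeta <= e) ->
  (forall i j, (i < n)%N -> (j < m)%N -> 0 <= w i j) ->
  (forall i, (i < n)%N -> \sum_(j < m) w i j = val (t i.+1) - val (t i)) ->
  (forall i j, (i < n)%N -> (j < m)%N -> 0 < w i j ->
    val (t i) <= val (z i j) < val (t i.+1)) ->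
  \sum_(i < n) \sum_(j < m) `|f (xi i) - f (z i j)| * w i j <= e.
Proof.
move=> P X osc w0 sw zin.
have worst i : exists x : ray b, (i < n)%N -> val (t i) <= val x < val (t i.+1) /\
    forall j, (j < m)%N -> 0 < w i j -> `|f (xi i) - f (z i j)| <= `|f (xi i) - f x|.
  have [lt_in|] := boolP (i < n)%N; last by exists (xi i).
  suff H k : (k <= m)%N -> exists x : ray b, val (t i) <= val x < val (t i.+1) /\
      forall j, (j < k)%N -> 0 < w i j -> `|f (xi i) - f (z i j)| <= `|f (xi i) - f x|.
    by have [x hx] := H m (leqnn _); exists x.
  elim: k => [_|k IH lt_km]; first by exists (xi i); split=> //; exact: X.
  have [x [xt hx]] := IH (ltnW lt_km).
  have [wk|wk] := ltP 0 (w i k); last first.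
    exists x; split=> // j; rewrite ltnS leq_eqVlt => /orP[/eqP->|]; last exact: hx.
    by rewrite ltNge wk.
  have [lexk|ltxk] := leP `|f (xi i) - f (z i k)| `|f (xi i) - f x|.
    exists x; split=> // j; rewrite ltnS leq_eqVlt => /orP[/eqP->//|]; exact: hx.
  exists (z i k); split; first exact: zin.
  move=> j; rewrite ltnS leq_eqVlt => /orP[/eqP->//|ltjk wj].
  by rewrite (le_trans (hx _ ltjk wj))// ltW.
have [zeta hz] := choice worst.
have Z : tags n t zeta by move=> i /hz[].
apply: le_trans (osc _ Z); apply: ler_sum => i _.
rewrite -sw// mulr_sumr; apply: ler_sum => j _.
have := w0 _ _ (ltn_ord i) (ltn_ord j); rewrite le_eqVlt => /orP[/eqP<-|wj].
  by rewrite !mulr0.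
by rewrite ler_pM2r//; have [_] := hz _ (ltn_ord i); exact.
Qed.

Lemma sum_overlap d u v n t (a a' : R) : fine_partition d u v n t ->
  val u <= a -> a <= a' -> a' <= val v ->
  \sum_(j < n) overlap a a' (val (t j)) (val (t j.+1)) = a' - a.
Proof.
move=> [t0 tn _] ua aa av.
rewrite -(big_mkord xpredT (fun j => clip a a' (val (t j.+1)) - clip a a' (val (t j)))).
rewrite (@telescope_sumr _ 0%N n (fun j => clip a a' (val (t j))))// t0 tn /clip.
by rewrite (min_idPl av) (max_idPr aa) (min_idPr (le_trans ua aa)) (max_idPl ua).
Qed.

(** Two partitions need no common refinement to be compared: both Riemann sums
    are double sums weighted by the overlaps of their steps, and two steps that
    overlap share the point [z i j], the larger of their left endpoints, at
    which the two tags can be compared. *)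
Lemma riemann_sum_dist f d u v n t xi m q zeta e e' :
  fine_partition d u v n t -> tags n t xi ->
  fine_partition d u v m q -> tags m q zeta ->
  (forall xi', tags n t xi' -> oscillation_sum f n t xi xi' <= e) ->
  (forall zeta', tags m q zeta' -> oscillation_sum f m q zeta zeta' <= e') ->
  `|riemann_sum f n t xi - riemann_sum f m q zeta| <= e + e'.
Proof.
move=> P X Q Z oP oQ.
pose w i j := overlap (val (t i)) (val (t i.+1)) (val (q j)) (val (q j.+1)).
pose z i j := if val (t i) <= val (q j) then q j else t i.
have wC i j : (i < n)%N -> (j < m)%N ->
    w i j = overlap (val (q j)) (val (q j.+1)) (val (t i)) (val (t i.+1)).
  by move=> ? ?; rewrite /w overlapC ?(fine_partition_step P) ?(fine_partition_step Q).
have w0 i j : (i < n)%N -> (j < m)%N -> 0 <= w i j.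
  by move=> ? ?; rewrite overlap_ge0// (fine_partition_step Q).
have swP i : (i < n)%N -> \sum_(j < m) w i j = val (t i.+1) - val (t i).
  move=> lt_in; apply: sum_overlap Q _ _ _; last 2 first.
  - exact: fine_partition_step P _.
  - by have /andP[] := fine_partition_bounds P lt_in.
  - by have /andP[] := fine_partition_bounds P (ltnW lt_in).
have swQ j : (j < m)%N -> \sum_(i < n) w i j = val (q j.+1) - val (q j).
  move=> lt_jm; under eq_bigr => i _ do rewrite wC//.
  apply: sum_overlap P _ _ _; last 2 first.
  - exact: fine_partition_step Q _.
  - by have /andP[] := fine_partition_bounds Q lt_jm.
  - by have /andP[] := fine_partition_bounds Q (ltnW lt_jm).
have zE i j : val (z i j) = Num.max (val (t i)) (val (q j)).
  by rewrite /z maxEle; case: ifP.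
have zin i j : (i < n)%N -> (j < m)%N -> 0 < w i j ->
    val (z i j) < Num.min (val (t i.+1)) (val (q j.+1)).
  by move=> lt_in lt_jm /overlap_gt0; rewrite zE; apply; exact: fine_partition_step P _.
have h1 : \sum_(i < n) \sum_(j < m) `|f (xi i) - f (z i j)| * w i j <= e.
  apply: oscillation_sum_refine P X oP w0 swP _ => i j lt_in lt_jm.
  by move=> /(zin _ _ lt_in lt_jm); rewrite lt_min zE le_max lexx => /andP[].
have h2 : \sum_(j < m) \sum_(i < n) `|f (zeta j) - f (z i j)| * w i j <= e'.
  apply: (oscillation_sum_refine (w := fun j i => w i j) (z := fun j i => z i j) Q Z oQ) => //.
  - by move=> j i ? ?; exact: w0.
  - move=> j i lt_jm lt_in.
    by move=> /(zin _ _ lt_in lt_jm); rewrite lt_min zE le_max lexx orbT => /andP[].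
have SP : riemann_sum f n t xi = \sum_(i < n) \sum_(j < m) f (xi i) * w i j.
  by apply: eq_bigr => i _; rewrite -mulr_sumr swP.
have SQ : riemann_sum f m q zeta = \sum_(i < n) \sum_(j < m) f (zeta j) * w i j.
  by rewrite exchange_big; apply: eq_bigr => j _; rewrite -mulr_sumr swQ.
rewrite SP SQ -sumrB (le_trans (ler_norm_sum _ _ _))//.
apply: le_trans (lerD h1 h2); rewrite [X in _ <= _ + X]exchange_big -big_split.
apply: ler_sum => i _; rewrite -sumrB (le_trans (ler_norm_sum _ _ _))//= -big_split.
apply: ler_sum => j _; rewrite /= -mulrBl normrM -mulrDl (ger0_norm (w0 _ _ _ _))//.
rewrite ler_wpM2r ?w0//.
by rewrite (distrC (f (zeta j))) ler_distD.
Qed.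

(** The integral is the lower limit of the Riemann sums along the partitions. *)
Lemma small_oscillation_delta_integrable f u v : val u <= val v ->
  small_oscillation f u v -> delta_integrable f u v.
Proof.
move=> uv osc.
pose A := [set x : R | exists2 d, 0 < d & forall n t xi,
  fine_partition d u v n t -> tags n t xi -> x <= riemann_sum f n t xi].
have close e : 0 < e -> exists2 d, 0 < d & forall n t xi,
    fine_partition d u v n t -> tags n t xi ->
    A (riemann_sum f n t xi - e) /\ ubound A (riemann_sum f n t xi + e).
  move=> e0; have [d d0 h] := osc _ (divr_gt0 e0 (ltr0n R 2)).
  have h' n t xi m q zeta : fine_partition d u v n t -> tags n t xi ->
      fine_partition d u v m q -> tags m q zeta ->
      `|riemann_sum f n t xi - riemann_sum f m q zeta| <= e.
    move=> P X Q Z; rewrite (splitr e); apply: (riemann_sum_dist P X Q Z).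
      by move=> xi' X'; exact: h P X X'.
    by move=> xi' X'; exact: h Q Z X'.
  exists d => // n t xi P X; split.
    exists d => // m q zeta Q Z; have := h' _ _ _ _ _ _ P X Q Z.
    by rewrite ler_norml => /andP[_ ?]; lra.
  move=> x [d' d'0 hx].
  have dd : 0 < Num.min d d' by rewrite lt_min d0.
  have [m [q Q]] := fine_partition_exists dd uv.
  have Q1 : fine_partition d u v m q by apply: fine_partition_le Q; rewrite ge_min lexx.
  have Q2 : fine_partition d' u v m q by apply: fine_partition_le Q; rewrite ge_min lexx orbT.
  have := hx _ _ _ Q2 (tags_self Q2); have := h' _ _ _ _ _ _ P X Q1 (tags_self Q1).
  by rewrite ler_norml => /andP[? _] ?; lra.
have Asup : has_sup A.
  have [d d0 h] := close _ ltr01; have [n [t P]] := fine_partition_exists d0 uv.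
  have [] := h _ _ _ P (tags_self P); split; first by eexists; eassumption.
  by eexists; eassumption.
exists (sup A) => e e0; have [d d0 h] := close _ (divr_gt0 e0 (ltr0n R 2)).
exists d => // n t xi P X; have [lo hi] := h _ _ _ P X.
have h1 := ub_le_sup Asup.2 lo; have h2 := ge_sup Asup.1 hi.
by rewrite ltr_norml; lra.
Qed.

(** Oscillation sums are monotone and additive in the pointwise differences, so
    a bound on the differences of [h] transfers smallness to [h]. *)
Lemma small_oscillation_dominated f g h C u v : 0 < C ->
  (forall x y, val u <= val x < val v -> val u <= val y < val v ->
    `|h x - h y| <= C * (`|f x - f y| + `|g x - g y|)) ->
  small_oscillation f u v -> small_oscillation g u v -> small_oscillation h u v.
Proof.
move=> C0 hC of_ og e e0; have e1 : 0 < e / C / 2 by rewrite !divr_gt0.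
have [d1 d10 h1] := of_ _ e1; have [d2 d20 h2] := og _ e1.
exists (Num.min d1 d2); first by rewrite lt_min d10.
move=> n t xi zeta P X Z.
have P1 : fine_partition d1 u v n t by apply: fine_partition_le P; rewrite ge_min lexx.
have P2 : fine_partition d2 u v n t by apply: fine_partition_le P; rewrite ge_min lexx orbT.
have le_osc : oscillation_sum h n t xi zeta <=
    C * (oscillation_sum f n t xi zeta + oscillation_sum g n t xi zeta).
  rewrite /oscillation_sum -big_split mulr_sumr; apply: ler_sum => i _ /=.
  rewrite -mulrDl mulrA ler_wpM2r ?subr_ge0 ?(fine_partition_step P)//.
  by apply: hC; [exact: (tag_bounds P X)|exact: (tag_bounds P Z)].
apply: le_trans le_osc _; rewrite -ler_pdivlMl// mulrC (splitr (e / C)).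
by apply: lerD; [exact: h1 P1 X Z|exact: h2 P2 X Z].
Qed.

Lemma locally_delta_integrable_dominated f g h :
  (forall u v, val u < val v -> exists2 C : R, 0 < C &
    forall x y, val u <= val x < val v -> val u <= val y < val v ->
      `|h x - h y| <= C * (`|f x - f y| + `|g x - g y|)) ->
  locally_delta_integrable f -> locally_delta_integrable g ->
  locally_delta_integrable h.
Proof.
move=> hC fi gi u v uv; have [C C0 hC'] := hC u v uv.
apply: small_oscillation_delta_integrable; first exact: ltW.
apply: (small_oscillation_dominated C0 hC');
  by apply: delta_integrable_small_oscillation; [exact: fi || exact: gi].
Qed.

Lemma locally_delta_integrableM f g :
  locally_delta_integrable f -> locally_delta_integrable g ->
  locally_delta_integrable (fun x => f x * g x).
Proof.
move=> fi gi; apply: locally_delta_integrable_dominated (fi) (gi) => u v uv.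
have [A hA] := delta_integrable_bounded uv (fi _ _ uv).
have [B hB] := delta_integrable_bounded uv (gi _ _ uv).
have AB0 : 0 <= A /\ 0 <= B.
  have uu : val u <= val u < val v by rewrite lexx.
  by split; [exact: le_trans (hA u uu)|exact: le_trans (hB u uu)].
exists (A + B + 1) => [|x y xI yI]; first by lra.
have -> : f x * g x - f y * g y = (f x - f y) * g x + f y * (g x - g y) by ring.
rewrite (le_trans (ler_normD _ _))// !normrM mulrDr; apply: lerD.
  by rewrite mulrC ler_wpM2r// (le_trans (hB _ xI))//; lra.
by rewrite ler_wpM2r// (le_trans (hA _ yI))//; lra.
Qed.

Lemma locally_delta_integrable_comp (phi : R -> R) (C : R) f : 0 < C ->
  (forall x y, `|phi x - phi y| <= C * `|x - y|) ->
  locally_delta_integrable f -> locally_delta_integrable (fun x => phi (f x)).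
Proof.
move=> C0 hphi fi; apply: locally_delta_integrable_dominated (fi) (fi) => u v _.
exists C => // x y _ _; rewrite (le_trans (hphi _ _))// ler_pM2l//.
by rewrite lerDl.
Qed.

Lemma locally_delta_integrable_norm f :
  locally_delta_integrable f -> locally_delta_integrable (fun x => `|f x|).
Proof.
apply: (@locally_delta_integrable_comp (fun x => `|x|) 1) => // x y.
by rewrite mul1r ler_dist_dist.
Qed.

Lemma locally_delta_integrableB f g :
  locally_delta_integrable f -> locally_delta_integrable g ->
  locally_delta_integrable (fun x => f x - g x).
Proof.
move=> fi gi; apply: locally_delta_integrable_dominated (fi) (gi) => u v _.
exists 1 => // x y _ _; rewrite mul1r opprD addrACA -opprD.
exact: ler_normB.
Qed.

End partitions.

(** * The integral over a bounded interval *)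

Section integral.
Context (R : realType) (T : timeScale R) (b : T).
Implicit Types (f g h : ray b -> R) (u v w : ray b).

Lemma is_delta_integral_refl f u : is_delta_integral f u u 0.
Proof.
move=> e e0; exists 1 => // -[|n] t xi P X.
  by rewrite /riemann_sum big_ord0 subrr normr0.
have /andP[ux xu] := tag_bounds P X (ltn0Sn n).
by have := le_lt_trans ux xu; rewrite ltxx.
Qed.

Lemma is_delta_integral_le f g u v (I J : R) : val u <= val v ->
  (forall w, val u <= val w < val v -> f w <= g w) ->
  is_delta_integral f u v I -> is_delta_integral g u v J -> I <= J.
Proof.
move=> uv fg fI gJ; rewrite leNgt; apply/negP => JI.
have e0 : 0 < (I - J) / 2 by lra.
have [d1 d10 h1] := fI _ e0; have [d2 d20 h2] := gJ _ e0.
have d0 : 0 < Num.min d1 d2 by rewrite lt_min d10.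
have [n [t P]] := fine_partition_exists d0 uv; have X := tags_self P.
have P1 : fine_partition d1 u v n t by apply: fine_partition_le P; rewrite ge_min lexx.
have P2 : fine_partition d2 u v n t by apply: fine_partition_le P; rewrite ge_min lexx orbT.
have := riemann_sum_le P X fg; have := h1 _ _ _ P1 X; have := h2 _ _ _ P2 X.
by rewrite !ltr_norml => /andP[? ?] /andP[? ?] ?; lra.
Qed.

Lemma delta_integral_eq f u v (I : R) : val u <= val v ->
  is_delta_integral f u v I -> delta_integral f u v = I.
Proof.
move=> uv fI; apply: xget_subset1 => // J J' fJ fJ'.
by apply/eqP; rewrite eq_le !(is_delta_integral_le uv (fun w _ => lexx (f w)))//.
Qed.

Lemma delta_integralP f u v : locally_delta_integrable f -> val u <= val v ->
  is_delta_integral f u v (delta_integral f u v).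
Proof.
move=> fi; rewrite le_eqVlt => /orP[/eqP uv|uv]; apply: xgetPex; last exact: fi.
by exists 0; rewrite (val_inj uv); exact: is_delta_integral_refl.
Qed.

Lemma delta_integral_le f g u v :
  locally_delta_integrable f -> locally_delta_integrable g -> val u <= val v ->
  (forall w, val u <= val w < val v -> f w <= g w) ->
  delta_integral f u v <= delta_integral g u v.
Proof. by move=> fi gi uv fg; apply: (is_delta_integral_le uv fg); exact: delta_integralP. Qed.

Lemma is_delta_integral_cst (c : R) u v :
  is_delta_integral (fun=> c) u v (c * (val v - val u)).
Proof.
move=> e e0; exists 1 => // n t xi P X.
by rewrite /riemann_sum -mulr_sumr (sum_steps P) subrr normr0.
Qed.

Lemma locally_delta_integrableZ (c : R) f :
  locally_delta_integrable f -> locally_delta_integrable (fun w => c * f w).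
Proof.
by move=> fi u v /fi[I fI]; exists (c * I); exact: is_delta_integralZ.
Qed.

Lemma delta_integralZ (c : R) f u v : locally_delta_integrable f -> val u <= val v ->
  delta_integral (fun w => c * f w) u v = c * delta_integral f u v.
Proof.
move=> fi uv; apply: delta_integral_eq => //.
exact: (is_delta_integralZ c (delta_integralP fi uv)).
Qed.

Lemma delta_integral_norm_le f h u v :
  locally_delta_integrable f -> locally_delta_integrable h -> val u <= val v ->
  (forall w, val u <= val w < val v -> `|f w| <= h w) ->
  `|delta_integral f u v| <= delta_integral h u v.
Proof.
move=> fi hi uv fh; rewrite ler_norml -mulN1r -delta_integralZ//.
have bnd w : val u <= val w < val v -> -1 * h w <= f w <= h w.
  by move=> /fh; rewrite ler_norml mulN1r.
apply/andP; split; apply: delta_integral_le => //; last 2 first.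
- by move=> w /bnd/andP[].
- by move=> w /bnd/andP[].
exact: locally_delta_integrableZ.
Qed.

Lemma delta_integral_ge0 f u v : locally_delta_integrable f -> val u <= val v ->
  (forall w, 0 <= f w) -> 0 <= delta_integral f u v.
Proof.
move=> fi uv f0; apply: (is_delta_integral_le uv) (delta_integralP fi uv).
  by move=> w _; exact: f0.
by have := is_delta_integral_cst 0 u v; rewrite mul0r.
Qed.

(** Fine partitions of [[u, v]] and [[v, w]] concatenate to a fine partition of
    [[u, w]]. *)
Lemma delta_integral_split f u v w : locally_delta_integrable f ->
  val u <= val v -> val v <= val w ->
  delta_integral f u w = delta_integral f u v + delta_integral f v w.
Proof.
move=> fi uv vw; have uw := le_trans uv vw.
set I := delta_integral f u w; set J := delta_integral f u v.
set J' := delta_integral f v w.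
have [//|ne] := eqVneq I (J + J').
have e0 : 0 < `|I - (J + J')| / 3 by rewrite divr_gt0// normr_gt0 subr_eq0.
have [d1 d10 h1] := delta_integralP fi uw e0.
have [d2 d20 h2] := delta_integralP fi uv e0.
have [d3 d30 h3] := delta_integralP fi vw e0.
pose d := Num.min d1 (Num.min d2 d3).
have d0 : 0 < d by rewrite !lt_min d10 d20.
have [n [t P]] := fine_partition_exists d0 uv.
have [m [q Q]] := fine_partition_exists d0 vw.
pose s i := if (i <= n)%N then t i else q (i - n)%N.
have [t0 tn ht] := P; have [q0 qm hq] := Q.
have sl i : (i <= n)%N -> s i = t i by rewrite /s => ->.
have sr i : s (n + i)%N = q i.
  rewrite /s addKn; case: ifP => //; rewrite -{2}[n]addn0 leq_add2l leqn0 => /eqP->.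
  by rewrite addn0 tn q0.
have S : fine_partition d u w (n + m) s.
  split; [by rewrite sl|by rewrite sr|move=> i lt_i].
  have [lt_in|le_ni] := ltnP i n; first by rewrite !sl ?(ltnW lt_in)//; exact: ht.
  rewrite -(subnKC le_ni) -addnS !sr; apply: hq.
  by rewrite -(ltn_add2l n) subnKC.
have sum_s : riemann_sum f (n + m) s s = riemann_sum f n t t + riemann_sum f m q q.
  rewrite /riemann_sum big_split_ord /=; congr (_ + _).
    by apply: eq_bigr => i _; rewrite !sl// ltnW.
  by apply: eq_bigr => i _; rewrite -addnS !sr.
have S1 : fine_partition d1 u w (n + m) s by apply: fine_partition_le S; rewrite ge_min lexx.
have P2 : fine_partition d2 u v n t.
  by apply: fine_partition_le P; rewrite !ge_min lexx orbT.
have Q3 : fine_partition d3 v w m q.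
  by apply: fine_partition_le Q; rewrite !ge_min lexx !orbT.
have := h1 _ _ _ S1 (tags_self S1); have := h2 _ _ _ P2 (tags_self P2).
have := h3 _ _ _ Q3 (tags_self Q3); rewrite sum_s -/I -/J -/J'.
move: e0; set D := _ / 3; rewrite !ltr_norml => D0 /andP[? ?] /andP[? ?] /andP[? ?].
have : `|I - (J + J')| < 3 * D by rewrite ltr_norml; lra.
by rewrite mulrC divfK// ltxx.
Qed.

(** * Continuous functions are integrable *)

Lemma ray_continuousP f : continuous f <-> forall x e, 0 < e ->
  exists2 d, 0 < d & forall y, `|val x - val y| < d -> `|f x - f y| < e.
Proof.
split=> [fc x e e0|h x].
  have /cvgrPdist_lt/(_ e e0)/nbhs_ballP[d d0 hd] := fc x.
  by exists d => // y xy; exact: hd.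
apply/(@cvgrPdist_lt _ _ _ (nbhs x) (nbhs_filter x)) => e e0; have [d d0 hd] := h x e e0.
by apply/nbhs_ballP; exists d => // y; exact: hd.
Qed.

(** Compactness is applied to the trace of the time scale on [[b, v]], as a
    covering statement: a modulus [d] valid near each point can be chosen
    uniformly. *)
Lemma ray_uniformly_continuous f v (e : R) : continuous f -> 0 < e ->
  exists2 d, 0 < d & forall x y : ray b, val x <= val v ->
    `|val x - val y| < d -> `|f x - f y| < e.
Proof.
move=> /ray_continuousP fc e0.
have K : compact (`[val b, val v] `&` ts_set T).
  by apply: compact_closedI; [exact: segment_compact|exact: ts_closed].
pose P (d z : R) := forall x y : ray b, val x = z ->
  `|val x - val y| < d -> `|f x - f y| < e.
have cover z : (`[val b, val v] `&` ts_set T) z ->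
    \forall z' \near z & d \near 0^'+, P d z'.
  move=> -[/=]; rewrite in_itv/= => /andP[bz _] Tz.
  have [d d0 hd] := fc (ray_at Tz bz) _ (divr_gt0 e0 (ltr0n R 2)).
  have d2 : 0 < d / 2 by rewrite divr_gt0.
  exists (ball z (d / 2), [set r | r < d / 2]).
    by split; [exact: nbhsx_ballx|exact: nbhs_right_lt].
  move=> [z' r] /= [zz' rd] x y xz' xy; rewrite (splitr e).
  rewrite /ball/= in zz'.
  rewrite (le_lt_trans (ler_distD (f (ray_at Tz bz)) _ _))// ltrD//.
    rewrite distrC; apply: hd => /=; rewrite xz' (lt_trans zz')//; lra.
  apply: hd => /=; rewrite (le_lt_trans (ler_distD (val x) _ _))// (splitr d) ltrD//.
    by rewrite xz'.
  exact: lt_trans xy rd.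
have /compact_near_coveringP/(_ _ _ P _ cover) hP := K.
have [d [d0 hd]] : exists d : R, 0 < d /\ (`[val b, val v] `&` ts_set T) `<=` P d.
  by near (0:R)^'+ => d; exists d; split; [near: d; exact: nbhs_right_gt|near: d].
exists d => // x y xv; apply: hd => //; split; last exact: ray_ts.
by rewrite /= in_itv/= xv ray_ge.
Unshelve. all: by end_near. Qed.

(** On a step longer than [d] of a fine partition there is no oscillation at
    all, because its left endpoint is its only point in the time scale. *)
Lemma continuous_locally_delta_integrable f :
  continuous f -> locally_delta_integrable f.
Proof.
move=> fc u v uv; apply: small_oscillation_delta_integrable; first exact: ltW.
move=> e e0; have l0 : 0 < val v - val u by rewrite subr_gt0.
have [d d0 hd] := ray_uniformly_continuous v fc (divr_gt0 e0 l0).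
exists d => // n t xi zeta P X Z.
have -> : e = \sum_(i < n) e / (val v - val u) * (val (t i.+1) - val (t i)).
  by rewrite -mulr_sumr (sum_steps P) divfK// lt0r_neq0.
apply: ler_sum => i _; have [_ _ /(_ _ (ltn_ord i))[lt_t ht]] := P.
rewrite ler_wpM2r ?subr_ge0// ?(ltW lt_t)//.
have /andP[x1 x2] := X _ (ltn_ord i); have /andP[z1 z2] := Z _ (ltn_ord i).
case: ht => [le_d|[_ rho]]; last first.
  have left_end (w : ray b) : val (t i) <= val w -> val w < val (t i.+1) -> w = t i.
    move=> tw wt; apply: val_inj; apply/eqP; rewrite eq_le tw andbT -rho.
    apply: ub_le_sup; last by split=> //; exact: ray_ts.
    by exists (val (t i.+1)) => s [_ /ltW].
  by rewrite (left_end _ x1 x2) (left_end _ z1 z2) subrr normr0 ltW// divr_gt0.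
(* Two tags in a step of length at most [d] are at distance less than [d], as
   the right endpoint of the step is not a tag. *)
apply/ltW/hd; last by rewrite ltr_norml; lra.
by have /andP[_ /ltW] := tag_bounds P X (ltn_ord i).
Qed.

End integral.

(** * Improper integrals *)

Section improper.
Context (R : realType) (T : timeScale R) (b : T).
Implicit Types (f g h : ray b -> R) (u v w : ray b).

Lemma ray_oo_gt (A : R) : \forall v \near ray_oo b, A < val v.
Proof. by exists A. Qed.

Lemma improper_integral_eq f u (I : R) :
  is_improper_integral f u I -> improper_integral f u = I.
Proof.
move=> fI; apply: xget_subset1 => // J J' [_ fJ] [_ fJ'].
exact: (cvg_unique (@Rhausdorff R) fJ fJ').
Qed.

Lemma improper_integralP f u : improper_integrable f u ->
  is_improper_integral f u (improper_integral f u).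
Proof. exact: xgetPex. Qed.

Lemma improper_integral_cvg f u : improper_integrable f u ->
  delta_integral f u v @[v --> ray_oo b] --> improper_integral f u.
Proof. by move=> /improper_integralP[]. Qed.

Lemma improper_integral_norm_le f u (B : R) : improper_integrable f u ->
  (forall v, val u <= val v -> `|delta_integral f u v| <= B) ->
  `|improper_integral f u| <= B.
Proof.
move=> fi fB; apply: (cvgr_to_le (cvg_norm (improper_integral_cvg fi))).
by apply: filterS (ray_oo_gt (val u)) => v /ltW; exact: fB.
Qed.

Lemma delta_integral_le_improper h u v : locally_delta_integrable h ->
  (forall w, 0 <= h w) -> improper_integrable h u -> val u <= val v ->
  delta_integral h u v <= improper_integral h u.
Proof.
move=> hl h0 hi uv; apply: (cvgr_to_ge (improper_integral_cvg hi)).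
apply: filterS (ray_oo_gt (val v)) => w /ltW vw.
by rewrite (delta_integral_split hl uv vw) lerDl delta_integral_ge0.
Qed.

(** Comparison test: the integrals of [f] up to a large [v] satisfy the Cauchy
    criterion, since those of [h] do. *)
Lemma improper_integrable_dominated f h u :
  locally_delta_integrable f -> locally_delta_integrable h ->
  (forall w, `|f w| <= h w) -> improper_integrable h u -> improper_integrable f u.
Proof.
move=> fl hl fh hi.
have /cauchy_cvgP /cvg_ex [I fI] : cauchy (delta_integral f u v @[v --> ray_oo b]).
  apply: cauchy_exP => e e0.
  have /cvgrPdist_lt/(_ _ (divr_gt0 e0 (ltr0n R 2))) [A _ hA] := improper_integral_cvg hi.
  have [v] := @ray_unbounded _ _ b (Num.max A (val u)); rewrite gt_max => /andP[Av /ltW uv].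
  exists (delta_integral f u v).
  apply: filterS (ray_oo_gt (val v)) => w vw; rewrite /ball/= distrC.
  rewrite (delta_integral_split fl uv (ltW vw)) addrC addKr.
  rewrite (le_lt_trans (delta_integral_norm_le fl hl (ltW vw) (fun w _ => fh w)))//.
  have := hA v Av; have := hA w (lt_trans Av vw).
  rewrite (delta_integral_split hl uv (ltW vw)) !ltr_norml => /andP[? ?] /andP[? ?].
  lra.
by exists I; split=> // v uv; exact: fl.
Qed.

Lemma improper_integrableZ (c : R) h u : locally_delta_integrable h ->
  improper_integrable h u -> improper_integrable (fun w => c * h w) u.
Proof.
move=> hl hi; exists (c * improper_integral h u); split=> [v uv|].
  exact: (locally_delta_integrableZ c hl uv).
have : c * delta_integral h u v @[v --> ray_oo b] --> c * improper_integral h u.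
  by apply: cvgM; [exact: cvg_cst|exact: improper_integral_cvg].
apply: cvg_trans; apply: near_eq_cvg.
by apply: filterS (ray_oo_gt (val u)) => v /ltW uv; rewrite delta_integralZ.
Qed.

Lemma is_improper_integral_linear f g u (c I J : R) :
  locally_delta_integrable f -> locally_delta_integrable g ->
  is_improper_integral f u I -> is_improper_integral g u J ->
  is_improper_integral (fun w => c * f w + g w) u (c * I + J).
Proof.
move=> fl gl [_ fI] [_ gJ].
have lin v : val u <= val v -> is_delta_integral (fun w => c * f w + g w) u v
    (c * delta_integral f u v + delta_integral g u v).
  move=> uv; apply: is_delta_integralD; last exact: delta_integralP.
  exact: (is_delta_integralZ c (delta_integralP fl uv)).
split=> [v /ltW uv|]; first by eexists; exact: lin.
have : (c * delta_integral f u v + delta_integral g u v) @[v --> ray_oo b] --> c * I + J.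
  by apply: cvgD => //; apply: cvgM => //; exact: cvg_cst.
apply: cvg_trans; apply: near_eq_cvg.
by apply: filterS (ray_oo_gt (val u)) => v /ltW uv; rewrite (delta_integral_eq uv (lin v uv)).
Qed.

End improper.

(** * Integration against a fixed row of the kernel *)

Lemma divDr1_mul_le (R : realFieldType) (a c : R) :
  0 <= a -> 0 <= c -> a / (c + 1) * c <= a.
Proof.
move=> a0 c0; have c1 : 0 < c + 1 by rewrite ltr_wpDl.
by rewrite mulrAC ler_pdivrMr// ler_wpM2l// lerDl.
Qed.

Section row.
Context (R : realType) (T : timeScale R) (b : T).
Implicit Types (k : ray b -> R) (u v w : ray b) (f : C0 b).

Local Notation m := (ray_min b).

Lemma C0_locally_delta_integrable f : locally_delta_integrable f.
Proof. by have /set_mem[] := C0_mem f. Qed.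

Lemma C0_cvg0 f : f @ ray_oo b --> (0 : R).
Proof. by have /set_mem[] := C0_mem f. Qed.

Lemma C0_normE f : `|f| = C0_norm f.
Proof. by []. Qed.

Lemma ray_min_le v : val m <= val v.
Proof. exact: ray_ge. Qed.

Lemma delta_integralM_norm_le k f (C : R) u v : locally_delta_integrable k ->
  val u <= val v -> (forall w, val u <= val w -> `|f w| <= C) ->
  `|delta_integral (fun w => k w * f w) u v| <=
    C * delta_integral (fun w => `|k w|) u v.
Proof.
move=> ki uv fC; have kni := locally_delta_integrable_norm ki.
rewrite -delta_integralZ//; apply: delta_integral_norm_le => //.
- exact/locally_delta_integrableM/C0_locally_delta_integrable.
- exact: locally_delta_integrableZ.
- by move=> w /andP[uw _]; rewrite normrM mulrC ler_wpM2r// fC.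
Qed.

Lemma improper_integrableM k f : locally_delta_integrable k ->
  improper_integrable (fun w => `|k w|) m ->
  improper_integrable (fun w => k w * f w) m.
Proof.
move=> ki kii; have kni := locally_delta_integrable_norm ki.
apply: (@improper_integrable_dominated _ _ _ _ (fun w => `|f| * `|k w|)).
- exact/locally_delta_integrableM/C0_locally_delta_integrable.
- exact: locally_delta_integrableZ.
- by move=> w; rewrite normrM mulrC ler_wpM2r// C0_normE C0_le_norm.
- exact: improper_integrableZ.
Qed.

Lemma improper_integralM_norm_le k f : locally_delta_integrable k ->
  improper_integrable (fun w => `|k w|) m ->
  `|improper_integral (fun w => k w * f w) m| <=
    `|f| * improper_integral (fun w => `|k w|) m.
Proof.
move=> ki kii; apply: improper_integral_norm_le; first exact: improper_integrableM.
move=> v mv; rewrite (le_trans (delta_integralM_norm_le ki mv (fun w _ => C0_le_norm f w)))//.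
rewrite C0_normE ler_wpM2l ?(le_trans _ (C0_le_norm f m))//.
by apply: delta_integral_le_improper => //; exact: locally_delta_integrable_norm.
Qed.

Lemma locally_delta_integrable_val : locally_delta_integrable (fun w : ray b => val w).
Proof.
apply: continuous_locally_delta_integrable; apply/ray_continuousP => x e e0.
by exists e.
Qed.

(** The sign of [k] would be the optimal test function, but it need be neither
    integrable nor vanishing at infinity. It is replaced by the Lipschitz
    truncation of [k / eta], which loses at most [eta] pointwise, times a
    continuous cutoff equal to [1] up to [y] and to [0] after [y + 1]. *)
Lemma improper_integral_norm_approx k (e : R) : locally_delta_integrable k ->
  improper_integrable (fun w => `|k w|) m -> 0 < e ->
  exists2 f : C0 b, `|f| <= 1 &
    improper_integral (fun w => `|k w|) m - e <= improper_integral (fun w => k w * f w) m.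
Proof.
move=> ki kii e0; have kni := locally_delta_integrable_norm ki.
have /cvgrPdist_lt/(_ _ (divr_gt0 e0 (ltr0n R 2))) [A _ hA] := improper_integral_cvg kii.
have [y yA] := @ray_unbounded _ _ b A; have {}hA := hA y yA.
have my := ray_min_le y.
pose eta := e / 2 / (val y - val m + 1).
have l0 : 0 < val y - val m + 1 by lra.
have eta0 : 0 < eta by rewrite !divr_gt0.
pose sg w := clip (-1) 1 (eta^-1 * k w).
pose cut (w : ray b) := clip 0 1 (val y + 1 - val w).
have cut01 w : 0 <= cut w <= 1 by exact: clip_bounds.
have sg1 w : `|sg w| <= 1.
  by rewrite ler_norml clip_bounds//; lra.
have sgi : locally_delta_integrable sg.
  apply: (@locally_delta_integrable_comp _ _ _ (clip (-1) 1) 1) => //.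
    by move=> x z; rewrite mul1r clip_lip.
  exact: locally_delta_integrableZ.
have cuti : locally_delta_integrable cut.
  apply: (@locally_delta_integrable_comp _ _ _ (fun x => clip 0 1 (val y + 1 - x)) 1) => //.
    move=> x z; rewrite mul1r (le_trans (clip_lip _ _ _ _))//.
    by rewrite [X in `|X|](_ : _ = z - x) ?(distrC z)//; ring.
  exact: locally_delta_integrable_val.
have fC : C0_set (fun w => sg w * cut w).
  split; first exact: locally_delta_integrableM.
  apply: cvg_near_cst; apply: filterS (ray_oo_gt b (val y + 1)) => w yw.
  by rewrite /cut clip_le ?mulr0//; lra.
pose f := MkC0 (mem_set fC : _ \in C0_pred (b := b)).
have f1 : `|f| <= 1.
  rewrite C0_normE; apply: C0_norm_le => w /=; have /andP[c0 c1] := cut01 w.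
  by rewrite normrM (ger0_norm c0) mulr_ile1.
exists f => //.
have ksg w : 0 <= k w * sg w /\ `|k w| - eta <= k w * sg w by exact: truncation_sign.
have kf0 w : 0 <= k w * f w.
  by rewrite mulrA mulr_ge0//; [have [] := ksg w|have /andP[] := cut01 w].
have kfi : locally_delta_integrable (fun w => k w * f w).
  exact/locally_delta_integrableM/C0_locally_delta_integrable.
apply: le_trans (delta_integral_le_improper kfi kf0 (improper_integrableM f ki kii) my).
have lower : is_delta_integral (fun w => `|k w| + - eta) m y
    (delta_integral (fun w => `|k w|) m y + (- eta) * (val y - val m)).
  apply: is_delta_integralD; first exact: delta_integralP.
  exact: is_delta_integral_cst.
apply: le_trans (is_delta_integral_le my _ lower (delta_integralP kfi my)); last first.
  move=> w /andP[_ wy]; have [_ h] := ksg w.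
  have -> : f w = sg w by rewrite /= /cut clip_ge ?mulr1//; lra.
  exact: h.
have : eta * (val y - val m) <= e / 2.
  by apply: divDr1_mul_le; lra.
by move: hA; rewrite ltr_norml => /andP[? ?]; lra.
Qed.

End row.

(** * The integral operator *)

Lemma linear_exists (R : pzRingType) (U V : lmodType R) (f : U -> V) :
  linear f -> exists L : {linear U -> V}, L =1 f.
Proof.
move=> lf; pose M := GRing.isLinear.Build R U V _ f lf.
by exists (HB.pack_for {linear U -> V} f M).
Qed.

Section operator.
Context (R : realType) (T1 T2 : timeScale R) (alpha : T1) (beta : T2).
Context (K : ray alpha -> ray beta -> R).
Implicit Types (x : ray alpha) (f : C0 beta).

Local Notation m := (ray_min beta).

Context (K_int : forall x, locally_delta_integrable (K x)).
Context (K_norm_int : forall x, improper_integrable (fun t => `|K x t|) m).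

Definition kernel_op f x : R := improper_integral (fun t => K x t * f t) m.

Lemma kernel_opP f x : is_improper_integral (fun t => K x t * f t) m (kernel_op f x).
Proof. exact/improper_integralP/improper_integrableM. Qed.

Let Kf_int f x : locally_delta_integrable (fun t => K x t * f t).
Proof. exact/locally_delta_integrableM/C0_locally_delta_integrable. Qed.

Lemma kernel_op_linear (a : R) (f g : C0 beta) x :
  kernel_op (a *: f + g) x = a * kernel_op f x + kernel_op g x.
Proof.
apply: improper_integral_eq.
have := is_improper_integral_linear a (@Kf_int f x) (@Kf_int g x) (kernel_opP f x) (kernel_opP g x).
congr is_improper_integral; apply/funext => t /=.
by rewrite mulrDr mulrCA.
Qed.

Lemma kernel_op_dist f x x0 :
  improper_integrable (fun t => `|K x t - K x0 t|) m ->
  `|kernel_op f x - kernel_op f x0| <=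
    `|f| * improper_integral (fun t => `|K x t - K x0 t|) m.
Proof.
move=> di.
have -> : kernel_op f x - kernel_op f x0 = improper_integral (fun t => (K x t - K x0 t) * f t) m.
  apply/esym/improper_integral_eq; rewrite addrC -mulN1r.
  have := is_improper_integral_linear (-1) (@Kf_int f x0) (@Kf_int f x) (kernel_opP f x0) (kernel_opP f x).
  congr is_improper_integral; apply/funext => t /=.
  by rewrite mulN1r mulrBl addrC.
apply: improper_integralM_norm_le => //.
exact: locally_delta_integrableB.
Qed.

(** The limits in the hypothesis are along punctured neighbourhoods; at the
    centre itself the difference vanishes. *)
Lemma kernel_op_continuous f :
  (forall x x0, improper_integrable (fun t => `|K x t - K x0 t|) m) ->
  (forall x0, improper_integral (fun t => `|K x t - K x0 t|) m @[x --> x0^'] --> (0 : R)) ->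
  continuous (kernel_op f).
Proof.
move=> di dlim x0.
apply/(@cvgrPdist_lt _ _ _ (nbhs x0) (nbhs_filter x0)) => e e0.
have f1 : 0 < `|f| + 1 by rewrite ltr_wpDl.
have h : \forall x \near nbhs x0, x != x0 ->
    `|0 - improper_integral (fun t => `|K x t - K x0 t|) m| < e / (`|f| + 1).
  apply: (@cvgr_dist_lt _ _ _ x0^' (dnbhs_filter x0) _ _ (dlim x0)).
  exact: divr_gt0.
apply: (@filterS _ _ (nbhs_filter x0) _ _ _ h) => x hx.
have [->|/hx] := eqVneq x x0; first by rewrite subrr normr0.
rewrite sub0r normrN ltr_pdivlMr// mulrC => hI; rewrite distrC.
apply: le_lt_trans (kernel_op_dist f (di x x0)) (le_lt_trans _ hI).
apply: le_trans (ler_wpM2l _ (ler_norm _)) _ => //.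
by rewrite ler_wpM2r// lerDl.
Qed.

(** The integral splits at a point beyond which [f] is small: the first part is
    small for large [x] because the kernel escapes to infinity, the second one
    for all [x] because the rows are uniformly bounded by [M]. *)
Lemma kernel_op_cvg0 f (M : R) :
  (forall x, improper_integral (fun t => `|K x t|) m <= M) ->
  (forall y, delta_integral (fun t => `|K x t|) m y @[x --> ray_oo alpha] --> (0 : R)) ->
  kernel_op f x @[x --> ray_oo alpha] --> (0 : R).
Proof.
move=> KM Klim; apply/cvgrPdist_le => e e0.
have kn x := locally_delta_integrable_norm (@K_int x).
have M0 : 0 <= M.
  apply: le_trans (KM (ray_min alpha)).
  apply: le_trans (delta_integral_le_improper (kn _) _ _ (lexx _)) => //.
  exact: delta_integral_ge0.
have e1 : 0 < e / 2 / (M + 1) by rewrite !divr_gt0//; lra.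
have e2 : 0 < e / 2 / (`|f| + 1) by rewrite !divr_gt0// ltr_wpDl.
have /cvgrPdist_lt/(_ _ e1) [A _ hA] := C0_cvg0 f.
have [y yA] := @ray_unbounded _ _ beta A.
have fy t : val y <= val t -> `|f t| <= e / 2 / (M + 1).
  move=> /(lt_le_trans yA) /hA; rewrite sub0r normrN; exact: ltW.
have my := ray_min_le y.
have /cvgrPdist_lt/(_ _ e2) := Klim y; apply: filterS => x; rewrite !sub0r !normrN => hx.
have Iy : `|delta_integral (fun t => K x t * f t) m y| <= e / 2.
  apply: le_trans (delta_integralM_norm_le (@K_int x) my (fun t _ => C0_le_norm f t)) _.
  rewrite -C0_normE; apply: le_trans (ler_wpM2l _ (le_trans (ler_norm _) (ltW hx))) _ => //.
  by rewrite mulrC; apply: divDr1_mul_le => //; rewrite divr_ge0// ltW.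
(* The bound is proved for the integrals over [[m, v]] with [v] beyond [y], of
   which the improper integral is the limit. *)
apply: (cvgr_to_le (cvg_norm (improper_integral_cvg (improper_integrableM f (@K_int x) (K_norm_int x))))).
apply: filterS (ray_oo_gt beta (val y)) => v /ltW yv.
rewrite (delta_integral_split (@Kf_int f x) my yv) (le_trans (ler_normD _ _))// (splitr e) lerD//.
apply: le_trans (delta_integralM_norm_le (@K_int x) yv fy) _.
have IM : delta_integral (fun t => `|K x t|) y v <= M.
  apply: le_trans (KM x).
  apply: le_trans (delta_integral_le_improper (kn x) _ (K_norm_int x) (ray_min_le v)) => //.
  by rewrite (delta_integral_split (kn x) my yv) lerDr delta_integral_ge0.
apply: le_trans (ler_wpM2l (ltW e1) IM) _.
by apply: divDr1_mul_le => //; rewrite divr_ge0// ltW.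
Qed.

End operator.

Theorem theorem7 (R : realType) (T1 T2 : timeScale R) (alpha : T1) (beta : T2)
    (K : ray alpha -> ray beta -> R) (M : R)
    (K_int : forall x, locally_delta_integrable (K x))
    (i_int : forall x x0,
      improper_integrable (fun t => `|K x t - K x0 t|) (ray_min beta))
    (i_lim : forall x0 : ray alpha,
      improper_integral (fun t => `|K x t - K x0 t|) (ray_min beta)
        @[x --> x0^'] --> (0 : R))
    (ii_int : forall x, improper_integrable (fun t => `|K x t|) (ray_min beta))
    (ii_bnd : has_ubound
      (range (fun x => improper_integral (fun t => `|K x t|) (ray_min beta))))
    (ii_sup : M = sup
      (range (fun x => improper_integral (fun t => `|K x t|) (ray_min beta))))
    (iii_lim : forall y : ray beta,
      delta_integral (fun t => `|K x t|) (ray_min beta) y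
        @[x --> ray_oo alpha] --> (0 : R)) :
  exists L : {linear C0 beta -> C0 alpha},
    [/\ forall (f : C0 beta) (x : ray alpha),
          is_improper_integral (fun t => K x t * f t) (ray_min beta) (L f x),
        bounded_operator L
      & operator_norm L = M].
Proof.
have KM x : improper_integral (fun t => `|K x t|) (ray_min beta) <= M.
  by rewrite ii_sup; apply: ub_le_sup => //; exists x.
have LC f : C0_set (kernel_op K f).
  split; last exact: kernel_op_cvg0 KM iii_lim.
  by apply: continuous_locally_delta_integrable; exact: kernel_op_continuous.
pose L0 f : C0 alpha := MkC0 (mem_set (LC f) : _ \in C0_pred (b := alpha)).
have [L LE] : exists L : {linear C0 beta -> C0 alpha}, L =1 L0.
  apply: linear_exists => a f g; apply: val_inj; apply/funext => x /=.
  exact: kernel_op_linear.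
have LfE f x : L f x = kernel_op K f x by rewrite LE.
have Lle f : `|L f| <= M * `|f|.
  rewrite C0_normE; apply: C0_norm_le => x; rewrite LfE mulrC.
  by rewrite (le_trans (improper_integralM_norm_le f (K_int x) (ii_int x)))// ler_wpM2l.
have norm_ub : ubound [set `|L f| | f in [set f : C0 beta | `|f| <= 1]] M.
  move=> _ [f /= f1 <-]; rewrite (le_trans (Lle f))// ler_piMr//.
  apply: le_trans (KM (ray_min alpha)).
  apply: le_trans (normr_ge0 _) (improper_integral_norm_le (ii_int _) _) => v mv.
  rewrite ger0_norm; last first.
    by apply: delta_integral_ge0 => //; exact: locally_delta_integrable_norm.
  by apply: delta_integral_le_improper => //; exact: locally_delta_integrable_norm.
exists L; split=> [f x| |].
- by rewrite LfE; exact: kernel_opP.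
- by exists M.
apply/eqP; rewrite eq_le; apply/andP; split.
  by apply: ge_sup norm_ub; exists `|L 0|; exists 0 => //=; rewrite normr0.
rewrite [leLHS]ii_sup; apply: ge_sup.
  by eexists; exists (ray_min alpha).
move=> _ [x _ <-]; apply/ler_addgt0Pr => e e0.
have [f f1 hf] := improper_integral_norm_approx (K_int x) (ii_int x) e0.
rewrite -lerBlDr (le_trans hf)// (le_trans (ler_norm _))//.
have -> : improper_integral (fun w => K x w * f w) (ray_min beta) = L f x by rewrite LfE.
apply: le_trans (C0_le_norm _ _) _; rewrite -C0_normE.
by apply: ub_le_sup; [exists M|exists f].
Qed.
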